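(* The Urysohn universal space $\mathbb{U}$ is not hyperconvex.
   Context: The Urysohn universal space $(\mathbb{U},\rho)$ is the (unique up to isometry) complete separable metric space that contains an isometric image of every separable metric space and has the finite transitivity property: every isometry between finite subsets of $\mathbb{U}$ extends to an isometry of $\mathbb{U}$ onto itself. $B(x,r)$ denotes the closed ball centered at $x$ with radius $r>0$. A metric space $(X,d)$ is hyperconvex if $\bigcap_{i\in I}B(x_i,r_i)\neq\emptyset$ for every (arbitrary, possibly infinite) nonempty collection $\{B(x_i,r_i)\}_{i\in I}$ of closed balls in $X$ for which $d(x_i,x_j)\leq r_i+r_j$ for all $i,j\in I$. *)

(* Defs.v *)
From mathcomp Require Import all_boot all_order all_algebra.
From mathcomp Require Import all_classical all_reals all_analysis.

Set Implicit Arguments.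
Unset Strict Implicit.
Unset Printing Implicit Defensive.

Import Order.TTheory GRing.Theory Num.Theory.

Local Open Scope classical_set_scope.
Local Open Scope ring_scope.

(* The library's [closed_ball] is the closure of the open ball, which in a
   general metric space may be strictly smaller than the set below. *)
Definition mclosed_ball (R : realType) (X : metricType R) (x : X) (r : R) :
    set X :=
  [set y | mdist x y <= r].

Definition hyperconvex (R : realType) (X : metricType R) : Prop :=
  forall (I : Type) (x : I -> X) (r : I -> R),
    inhabited I ->
    (forall i, 0 < r i) ->
    (forall i j, mdist (x i) (x j) <= r i + r j) ->
    \bigcap_i mclosed_ball (x i) (r i) !=set0.

(* [f] restricts to an isometry of [A] onto [B]; its values outside [A] are
   irrelevant. *)
Definition isometry_onto (R : realType) (X Y : metricType R)
    (A : set X) (B : set Y) (f : X -> Y) : Prop :=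
  f @` A = B /\ {in A &, forall x y, mdist (f x) (f y) = mdist x y}.

(* The axiom of [completeType], which itself is not used because it carries a
   distinguished point. *)
Definition complete_space (X : uniformType) : Prop :=
  forall F : set_system X, ProperFilter F -> cauchy F -> exists l : X, F --> l.

Definition separable_space (X : topologicalType) : Prop :=
  exists2 D : set X, countable D & dense D.

Definition isometrically_universal (R : realType) (U : metricType R) : Prop :=
  forall X : metricType R, separable_space X ->
    exists (B : set U) (f : X -> U), isometry_onto setT B f.

Definition finitely_transitive (R : realType) (U : metricType R) : Prop :=
  forall (A B : set U) (f : U -> U),
    finite_set A -> finite_set B -> isometry_onto A B f ->
    exists g : U -> U, isometry_onto setT setT g /\ {in A, g =1 f}.

(* These properties determine [U] up to isometry. *)
Definition is_urysohn_space (R : realType) (U : metricType R) : Prop :=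
  [/\ complete_space U, separable_space U,
      isometrically_universal U & finitely_transitive U].

(* Main.v *)
Require Import Defs.
From HB Require Import structures.
From mathcomp Require Import all_boot all_order all_algebra.
From mathcomp Require Import all_classical all_reals all_analysis.
From mathcomp Require Import lra.

(** Suppose [x] and [y] lie at distance 2.  If a point [w] is at distance at
    most 1 from both, then it is at distance exactly 1 from both, by the
    triangle inequality.  In the Urysohn space such a midpoint [w] always has an
    antipode: the 4-cycle [x, w, y, z], with its path metric, is a metric space,
    so its three vertices [x], [w], [y] already present in the space are
    completed by some [z] there ([isometry_extension]).  This [z] is again a
    midpoint of [x] and [y], and it is at distance 2 from [w].

    On the other hand, the metric segment from [x] to [y] has diameter 2, so
    hyperconvexity applies to the balls of radius 1 around all its points.  It
    gives a midpoint [w] within distance 1 of every midpoint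
    ([hyperconvex_central_midpoint]), and this contradicts the existence of the
    antipode of [w] ([antipodal_midpoint]). *)

Import Order.TTheory GRing.Theory Num.Theory.
Local Open Scope classical_set_scope.
Local Open Scope ring_scope.

(** The vertex set of a square, a type distinct from [bool * bool] so that
    its metric is not confused with the product metric; the parameter tells
    instance inference in which field that metric takes its values. *)
Definition four_cycle (R : realType) : Type := (bool * bool)%type.

HB.instance Definition _ (R : realType) :=
  Choice.copy (four_cycle R) (bool * bool)%type.

(** The Hamming distance, which is the path metric of the 4-cycle. *)
Definition hamming (R : realType) (p q : four_cycle R) : R :=
  (p.1 != q.1)%:R + (p.2 != q.2)%:R.

Lemma hammingxx (R : realType) (p : four_cycle R) : hamming R p p = 0.
Proof. by rewrite /hamming !eqxx addr0. Qed.

Lemma hamming_eq0 (R : realType) (p q : four_cycle R) :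
  hamming R p q = 0 -> p = q.
Proof.
by move: p q => [[] []] [[] []]; rewrite /hamming /= // => ?; exfalso; lra.
Qed.

Lemma hammingC (R : realType) (p q : four_cycle R) :
  hamming R p q = hamming R q p.
Proof. by rewrite /hamming (eq_sym p.1) (eq_sym p.2). Qed.

Lemma hamming_triangle (R : realType) (q p s : four_cycle R) :
  hamming R p s <= hamming R p q + hamming R q s.
Proof.
by move: p q s => [[] []] [[] []] [[] []]; rewrite /hamming /=; lra.
Qed.

HB.instance Definition _ (R : realType) :=
  isMetric.Build R (four_cycle R) (@hammingxx R) (@hamming_eq0 R)
    (@hammingC R) (@hamming_triangle R).

Lemma mdist_four_cycle (R : realType) (p q : four_cycle R) :
  mdist p q = hamming R p q.
Proof. by []. Qed.

Lemma separable_four_cycle (R : realType) : separable_space (four_cycle R).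
Proof.
exists setT; last by move=> O [p Op] _; exists p.
by apply: finite_set_countable; exact: (@finite_finset (bool * bool)%type).
Qed.

(** Universality provides some copy of [X] in [U], and finite transitivity
    moves the image of [A] to the prescribed position. *)
Lemma isometry_extension (R : realType) (U X : metricType R)
    (A : set X) (u : X -> U) :
  isometrically_universal U -> finitely_transitive U ->
  separable_space X -> finite_set A ->
  {in A &, forall p q, mdist (u p) (u q) = mdist p q} ->
  exists h : X -> U,
    (forall p q, mdist (h p) (h q) = mdist p q) /\ {in A, h =1 u}.
Proof.
move=> univ trans sepX finA uiso.
have [B [f [_ fiso]]] := univ X sepX.
have {}fiso p q : mdist (f p) (f q) = mdist p q by apply: fiso; rewrite inE.
have finj p q : f p = f q -> p = q.
  by move=> fpq; apply: mdist_positivity; rewrite -fiso fpq mdistxx.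
(* On the range of [f], [phi] inverts [f] and then applies [u]. *)
pose phi v := if pselect (exists p, f p = v) is left e
  then u (projT1 (cid e)) else v.
have phif p : phi (f p) = u p.
  rewrite /phi; case: pselect => [e|]; last by case; exists p.
  by congr u; apply: finj; exact: (projT2 (cid e)).
have phi_iso : isometry_onto (f @` A) (u @` A) phi.
  split.
    by rewrite image_comp; apply: eq_imagel => p _ /=; rewrite phif.
  move=> _ _ /set_mem[p Ap <-] /set_mem[q Aq <-].
  by rewrite !phif fiso uiso// inE.
have [g [[_ giso] gphi]] := trans _ _ _ (finite_image f finA)
  (finite_image u finA) phi_iso.
exists (g \o f); split=> [p q|p Ap] /=; first by rewrite giso ?inE.
by rewrite gphi ?phif// inE; exists p => //; rewrite -inE.
Qed.

Definition midpoint (R : realType) (X : metricType R) (x y w : X) : Prop :=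
  mdist x w = 1 /\ mdist y w = 1.

Lemma antipodal_midpoint (R : realType) (U : metricType R) (x y w : U) :
  isometrically_universal U -> finitely_transitive U ->
  mdist x y = 2 -> midpoint R U x y w ->
  exists2 z, midpoint R U x y z & mdist w z = 2.
Proof.
move=> univ trans xy [xw yw].
pose a : four_cycle R := (false, false); pose b : four_cycle R := (true, true).
pose c : four_cycle R := (false, true); pose d : four_cycle R := (true, false).
pose u (p : four_cycle R) := if p == a then x else if p == b then y else w.
(* The image of [d] under the extension is the antipode, so [A] omits it. *)
pose A : set (four_cycle R) := [set p | p != d].
have finA : finite_set A by exact: (@finite_finset (bool * bool)%type).
have uiso : {in A &, forall p q, mdist (u p) (u q) = mdist p q}.
  move=> p q /set_mem /= pd /set_mem /= qd; rewrite mdist_four_cycle.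
  move: p q pd qd => [[] []] [[] []] //= _ _;
    rewrite /u /hamming /= ?mdistxx 1?[mdist y x]metric_sym
      1?[mdist w x]metric_sym 1?[mdist w y]metric_sym ?xy ?xw ?yw; lra.
have [h [hiso hu]] :=
  isometry_extension R U _ A u univ trans (separable_four_cycle R) finA uiso.
have ha : h a = x by rewrite hu ?inE.
have hb : h b = y by rewrite hu ?inE.
have hc : h c = w by rewrite hu ?inE.
exists (h d).
  by split; rewrite -?ha -?hb hiso mdist_four_cycle /hamming /=; lra.
by rewrite -hc hiso mdist_four_cycle /hamming /=; lra.
Qed.

Lemma exists_mdist2 (R : realType) (U : metricType R) :
  isometrically_universal U -> exists x y : U, mdist x y = 2.
Proof.
move=> univ.
have [B [f [_ fiso]]] := univ _ (separable_four_cycle R).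
exists (f (false, false)), (f (true, true)).
by rewrite fiso ?inE// mdist_four_cycle /hamming /=; lra.
Qed.

(** Two points [u] and [v] of the metric segment from [x] to [y] are at
    distance at most 2: the paths from [u] to [v] through [x] and through [y]
    have total length 4.  A common point of the unit balls around all points of
    the segment is a midpoint, since the endpoints are among the centers. *)
Lemma hyperconvex_central_midpoint (R : realType) (X : metricType R)
    (x y : X) :
  hyperconvex X -> mdist x y = 2 ->
  exists2 w, midpoint R X x y w &
    forall z, midpoint R X x y z -> mdist z w <= 1.
Proof.
move=> hyp xy; pose S := [set v | mdist x v + mdist y v = 2].
have Sx : S x by rewrite /S /= mdistxx metric_sym xy add0r.
have Sy : S y by rewrite /S /= mdistxx xy addr0.
have Sdiam u v : S u -> S v -> mdist u v <= 1 + 1.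
  rewrite /S /= => Su Sv.
  have viax := metric_triangle u x v; have viay := metric_triangle u y v.
  rewrite (metric_sym u x) in viax; rewrite (metric_sym u y) in viay; lra.
have [||[u Su] [v Sv]|w wS] := hyp {v | S v} (fun i => sval i) (fun=> 1).
- by constructor; exists x.
- by move=> _; exact: ltr01.
- exact: Sdiam.
have ball_w v : S v -> mdist v w <= 1.
  by move=> Sv; exact: (wS (exist _ v Sv) I).
have xw := ball_w _ Sx; have yw := ball_w _ Sy.
have tri := metric_triangle x w y; rewrite xy (metric_sym w y) in tri.
exists w; first by split; lra.
by move=> z [xz yz]; apply: ball_w; rewrite /S /= xz yz; lra.
Qed.

Theorem mainTheorem2 (R : realType) (U : metricType R) (HU : is_urysohn_space U) :
  ~ hyperconvex U.
Proof.
move=> hyp; have [_ _ univ trans] := HU.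
have [x [y xy]] := exists_mdist2 R U univ.
have [w wM near_w] := hyperconvex_central_midpoint R U x y hyp xy.
have [z zM wz] := antipodal_midpoint R U x y w univ trans xy wM.
by have := near_w z zM; rewrite metric_sym wz; lra.
Qed.
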